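(* For each $k\in\{1,2,3\}$, the three quantities $$\max\{N_k(P)\mid P\in\mathbb{N}^k\},\qquad \max\{N_k(P)\mid P\in(\mathbb{C}^k)^{\circ}\},\qquad N_k$$ are all equal to $2^k-1$. Moreover, $N_4((1,2,4,8))=15$.
   Context: $\mathbb{N}$ denotes the positive integers. $(\mathbb{C}^k)^\circ$ is the set of $(m_1,\ldots,m_k)\in\mathbb{C}^k$ with $\sum_{i\in S}m_i\neq0$ for every nonempty $S\subset\{1,\ldots,k\}$. Let $$e_n(y_1,\ldots,y_k,x_1,\ldots,x_k)=\sum_{i_1+\cdots+i_k=n}\binom{y_1}{i_1}\cdots\binom{y_k}{i_k}x_1^{i_1}\cdots x_k^{i_k},\qquad \binom yi=\frac{y(y-1)\cdots(y-i+1)}{i!}.$$ With $m_1,\ldots,m_k,x_1,\ldots,x_k$ indeterminates, let $$R_i=\mathbb{C}[m_1,\ldots,m_k]\Big[\Big\{\tfrac1{\sum_{s\in S}m_s}\Big\}_{\emptyset\ne S\subset\{1,\ldots,k\}}\Big]\big[\{e_j(m_1,\ldots,m_k,x_1,\ldots,x_k)\}_{1\le j\le i}\big].$$ $N_k$ is the least $i$ such that $R_i=R_{i+1}=R_{i+2}=\cdots$ (such $i$ exists). For $P=(m_1,\ldots,m_k)\in(\mathbb{C}^k)^\circ$, the $\mathbb{C}$-subalgebra of $\mathbb{C}[x_1,\ldots,x_k]$ generated by all $e_j(m_1,\ldots,m_k,x_1,\ldots,x_k)$, $j\ge1$, is finitely generated, and $\Delta^k_P(\mathbb{A}^1)$ is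 its spectrum. (For $P\in\mathbb{N}^k$ this is the variety of monic polynomials $(z-x_1)^{m_1}\cdots(z-x_k)^{m_k}$, $x_i\in\mathbb{C}$, in the affine space of monic degree $m_1+\cdots+m_k$ polynomials.) $N_k(P)$ is the minimal $n$ such that $\Delta^k_P(\mathbb{A}^1)$ embeds as a closed subvariety into $\mathbb{A}^n$. *)

(* Defs.v *)
From HB Require Import structures.
From mathcomp Require Import all_boot all_order all_algebra.
From mathcomp Require Import boolp classical_sets reals complex mpoly.

Set Implicit Arguments.
Unset Strict Implicit.
Unset Printing Implicit Defensive.

Import GRing.Theory.

Local Open Scope classical_set_scope.
Local Open Scope ring_scope.

Definition subring_gen (A : nzRingType) (G : set A) : set A :=
  smallest (fun S : set A => GRing.subring_closed (mem S)) G.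

Definition subalg_gen (K : fieldType) (A : comAlgType K) (G : set A) : set A :=
  smallest (fun S : set A => GRing.subalg_closed (mem S)) G.

(* [subalg_gen G] as an algebra in its own right *)
Section GeneratedAlgebra.
Variables (K : fieldType) (A : comAlgType K) (G : set A).

Definition in_subalg_gen : {pred A} := mem (subalg_gen G).

Lemma in_subalg_gen_closed : GRing.subalg_closed in_subalg_gen.
Proof.
split=> [|c u v|u v].
- by apply/mem_set => S [[S1 _ _] _]; apply/set_mem.
- move=> /set_mem Su /set_mem Sv; apply/mem_set => S HS.
  case: (HS) => -[_ Slin _] _; apply/set_mem/Slin; apply/mem_set.
    exact: (Su S HS).
  exact: (Sv S HS).
- move=> /set_mem Su /set_mem Sv; apply/mem_set => S HS.
  case: (HS) => -[_ _ Smul] _; apply/set_mem/Smul; apply/mem_set.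
    exact: (Su S HS).
  exact: (Sv S HS).
Qed.

HB.instance Definition _ :=
  GRing.isSubalgClosed.Build K A in_subalg_gen in_subalg_gen_closed.

Record genAlg := GenAlg {
  genAlg_val :> A;
  genAlg_valP : genAlg_val \in in_subalg_gen }.

HB.instance Definition _ := [isSub for genAlg_val].
HB.instance Definition _ := [Choice of genAlg by <:].
HB.instance Definition _ := [SubChoice_isSubComNzRing of genAlg by <:].
HB.instance Definition _ := [SubZmodule_isSubLmodule of genAlg by <:].
HB.instance Definition _ := [SubNzRing_SubLmodule_isSubLalgebra of genAlg by <:].
HB.instance Definition _ := [SubLalgebra_isSubAlgebra of genAlg by <:].

End GeneratedAlgebra.

Section AffineVarieties.
Variable K : fieldType.

Local Notation affine n := {ffun 'I_n -> K}.

Definition zariski_closed n (Z : set (affine n)) : Prop :=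
  exists I : set {mpoly K[n]}, Z = [set z | forall p, I p -> p.@[z] = 0].

Definition regular_on n (Z : set (affine n)) (g : affine n -> K) : Prop :=
  exists p : {mpoly K[n]}, forall z, Z z -> g z = p.@[z].

(* For K algebraically closed and B a reduced finitely generated K-algebra, the
   affine variety Spec B is given by its set of K-points, on which the regular
   functions are the evaluations at the elements of B. *)
Definition spec (B : comAlgType K) : Type := {lrmorphism B -> K^o}.

(* phi is an isomorphism of Spec B onto a closed subvariety of affine n-space:
   a bijection onto a closed set such that a function on that set is regular
   iff its pullback along phi is. *)
Definition closed_embedding (B : comAlgType K) n (phi : spec B -> affine n) :
    Prop :=
  [/\ injective phi,
      zariski_closed (range phi) &
      forall g : affine n -> K, regular_on (range phi) g <->
        exists b : B, forall x : spec B, g (phi x) = x b].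

Definition embeds_closed (B : comAlgType K) n : Prop :=
  exists phi : spec B -> affine n, closed_embedding phi.

End AffineVarieties.

Definition is_least (Q : nat -> Prop) n : Prop :=
  Q n /\ forall m, Q m -> (n <= m)%N.

(* M = max {N(P) | P in D}, where N is given by its graph; this includes that
   N is defined at every point of D. *)
Definition is_max_on (T : Type) (D : set T) (N : T -> nat -> Prop) (M : nat) :
    Prop :=
  (forall P, D P -> exists2 n, N P n & (n <= M)%N) /\
  (exists2 P, D P & N P M).

Definition gbinom (F : fieldType) (y : F) (i : nat) : F :=
  (\prod_(j < i) (y - j%:R)) / i`!%:R.

Definition e_poly (F : fieldType) k (y : {ffun 'I_k -> F}) (n : nat) :
    {mpoly F[k]} :=
  \sum_(i : 'X_{1..k < n.+1} | mdeg i == n)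
    (\prod_(s < k) gbinom (y s) (i s)) *: 'X_[i].

Section Universal.
Variables (K : fieldType) (k : nat).

Definition ratfun : fieldType := {fraction {mpoly K[k]}}.

Definition mvars : {ffun 'I_k -> ratfun} :=
  [ffun s => @tofrac {mpoly K[k]} 'X_s].

(* K[m_1, .., m_k][1 / sum_(s in S) m_s], as a subring of K(m_1, .., m_k) *)
Definition coef_ring : set ratfun :=
  subring_gen (range (@tofrac {mpoly K[k]}) `|`
    [set c | exists2 S : {set 'I_k}, S != finset.set0 &
             c = (\sum_(s in S) mvars s)^-1]).

(* R_i, as a subring of K(m_1, .., m_k)[x_1, .., x_k] *)
Definition Rring (i : nat) : set {mpoly ratfun[k]} :=
  subring_gen ((fun c => c%:MP) @` coef_ring `|`
               e_poly mvars @` [set j | (1 <= j <= i)%N]).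

Definition is_N : nat -> Prop :=
  is_least (fun i => forall j, (i <= j)%N -> Rring i = Rring j).

End Universal.

Section Pointwise.
Variables (K : fieldType) (k : nat).

(* (K^k)^o *)
Definition generic_points : set {ffun 'I_k -> K} :=
  [set P | forall S : {set 'I_k}, S != finset.set0 -> \sum_(s in S) P s != 0].

Definition posnat_points : set {ffun 'I_k -> K} :=
  [set P | forall s, exists2 m : nat, (0 < m)%N & P s = m%:R].

(* the coordinate ring of Delta^k_P(A^1) *)
Definition Delta_alg (P : {ffun 'I_k -> K}) : comAlgType K :=
  genAlg (e_poly P @` [set j | (1 <= j)%N]).

Definition is_N_at (P : {ffun 'I_k -> K}) : nat -> Prop :=
  is_least (embeds_closed (Delta_alg P)).

End Pointwise.

(* Main.v *)
From Stdlib Require Import BinNums BinInt.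
From HB Require Import structures.
Require Import Defs.
From mathcomp Require Import all_boot all_order all_algebra.
From mathcomp Require Import boolp classical_sets reals complex mpoly.
From mathcomp Require Import ssrZ ring zify.

(* By Newton's identities the e_j may be replaced by the weighted power sums
   p_j = sum_s m_s x_s^j.

   Upper bound for k <= 3: after a translation p_1 = 0, and then x_1, ..., x_k
   are roots of one monic polynomial of degree d = 2^k - 1 whose coefficients
   are polynomials in p_1, ..., p_d with denominators dividing a product of
   subset sums of the weights. This yields a recursion expressing all power sums
   through p_1, ..., p_d. For natural weights, e_j = 0 for j > sum_s m_s, which
   settles the upper bound for the weights (1, 2, 4, 8).

   Lower bound: an embedding into affine n-space gives n algebra generators.
   For the weights (1, 2, 4, ..., 2^(k-1)) with k <= 4 and each j < 2^k there is
   a linear form on polynomials which kills all decomposable products of power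
   sums but not p_j; it is given by explicit integer points and weights. These
   2^k - 1 forms are derivations at the origin, so n >= 2^k - 1. The bound for
   the universal ring follows by specialising its weights to (1, 2, 4, ...). *)

Set Implicit Arguments.
Unset Strict Implicit.
Unset Printing Implicit Defensive.

Import Order.TTheory GRing.Theory Num.Theory.

Local Open Scope classical_set_scope.
Local Open Scope ring_scope.

(** * Newton's identities *)

Section Newton.
Variables (F : fieldType) (k : nat) (y : {ffun 'I_k -> F}).
Hypothesis char0 : forall n, n.+1%:R != 0 :> F.

Definition psum (n : nat) : {mpoly F[k]} := \sum_s y s *: 'X_s ^+ n.

Lemma gbinomS (a : F) i : i.+1%:R * gbinom a i.+1 = (a - i%:R) * gbinom a i.
Proof.
have nf j : j`!%:R != 0 :> F by case: (j`!) (fact_gt0 j).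
rewrite /gbinom big_ord_recr /= factS natrM.
have cancel (b f P Q : F) : b != 0 -> f != 0 ->
  b * (P * Q / (b * f)) = Q * (P / f) by move=> *; field; apply/andP.
by rewrite cancel ?char0.
Qed.

(** Coefficient of $t^n$ in $t \frac{d}{dt}(1+t)^a = a t (1+t)^{-1} (1+t)^a$: Newton's identity for
    a single variable. *)
Lemma gbinom_newton (a : F) n :
  n%:R * gbinom a n = a * \sum_(i < n) (-1) ^+ i * gbinom a (n - i.+1).
Proof.
elim: n => [|n IHn]; first by rewrite big_ord0 mul0r mulr0.
rewrite gbinomS mulrBl IHn big_ord_recl expr0 mul1r subSS subn0 mulrDr.
congr (_ + _); rewrite -mulrN -sumrN; congr (_ * _); apply: eq_bigr => i _.
by rewrite exprS mulN1r mulNr.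
Qed.

Lemma mcoeff_e_poly n m :
  (e_poly y n)@_m = if mdeg m == n then \prod_s gbinom (y s) (m s) else 0.
Proof.
rewrite /e_poly big_mkcond /=.
pose E (i : 'X_{1..k}) := if mdeg i == n then \prod_s gbinom (y s) (i s) else 0.
rewrite (eq_bigr (fun i : 'X_{1..k < n.+1} => E i *: 'X_[i])); last first.
  by move=> i _; rewrite /E; case: eqP; rewrite ?scale0r.
have [lt_mn|le_nm] := ltnP (mdeg m) n.+1; first by rewrite mcoeff_mpoly.
rewrite raddf_sum /= big1 ?gtn_eqF// => i _; rewrite mcoeffZ mcoeffX.
case: eqP => [im|]; last by rewrite mulr0.
by move: (bmdeg i); rewrite im ltnNge le_nm.
Qed.

Lemma mcoeffXn_mul (p : {mpoly F[k]}) s i m :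
  ('X_s ^+ i * p)@_m = if (i <= m s)%N then p@_(m - U_(s) *+ i)%MM else 0.
Proof.
rewrite mpolyXn -commr_mpolyX; case: leqP => [le_im|lt_mi].
  rewrite -[in LHS](@submK _ (U_(s) *+ i)%MM m) ?[(_ - _ + _)%MM]addmC ?mcoeffMX//.
  apply/mnm_lepP => r; rewrite mulmnE mnm1E.
  by case: eqP => [<-|]; rewrite ?mul1n.
apply: memN_msupp_eq0; rewrite (perm_mem (msuppMX _ _)).
apply/mapP => -[m' _ mE]; move: lt_mi; rewrite mE mnmDE mulmnE mnm1E eqxx.
by rewrite mul1n ltnNge leq_addr.
Qed.

Lemma mdeg_subXn (m : 'X_{1..k}) s i : (i <= m s)%N ->
  mdeg (m - U_(s) *+ i)%MM = (mdeg m - i)%N.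
Proof.
move=> le_im; rewrite -[in RHS](@submK _ (U_(s) *+ i)%MM m); last first.
  apply/mnm_lepP => r; rewrite mulmnE mnm1E.
  by case: eqP => [<-|]; rewrite ?mul1n.
by rewrite mdegD mdegMn mdeg1 mul1n addnK.
Qed.

Lemma mcoeff_sign (p : {mpoly F[k]}) i m :
  ((-1) ^+ i * p)@_m = (-1) ^+ i * p@_m.
Proof.
rewrite -[in LHS]signr_odd -[in RHS]signr_odd !mulr_sign.
by case: odd; rewrite ?mcoeffN.
Qed.

(** The $e_n$ are the coefficients of $\prod_s (1 + x_s t)^{y_s}$, whose logarithmic derivative has
    the signed power sums as coefficients. In the coefficient of a monomial [m] of degree [n],
    writing [n] as the sum of the [m s] splits the left side by variables, and each summand is
    [gbinom_newton] times the other binomials. *)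
Lemma e_poly_newton n :
  n%:R *: e_poly y n =
  \sum_(i < n) (-1) ^+ i * (psum i.+1 * e_poly y (n - i.+1)).
Proof.
apply/mpolyP => m; rewrite mcoeffZ mcoeff_e_poly raddf_sum /=.
under [RHS]eq_bigr => i _.
  rewrite mcoeff_sign /psum mulr_suml raddf_sum mulr_sumr /=.
  under eq_bigr => s _.
    rewrite -scalerAl mcoeffZ mcoeffXn_mul mcoeff_e_poly.
  over.
over.
rewrite exchange_big /=; case: eqP => [mn|ne_mn]; last first.
  rewrite mulr0 big1// => s _; rewrite big1// => i _.
  case: ltnP => [le_im|_]; last by rewrite !mulr0.
  rewrite mdeg_subXn//.
  case: eqP => [E|_]; last by rewrite !mulr0.
  case: ne_mn.
  have: (m s <= mdeg m)%N by rewrite mdegE (bigD1 s) ?leq_addr.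
  move: le_im (ltn_ord i) E; lia.
rewrite -{1}mn mdegE natr_sum mulr_suml; apply: eq_bigr => s _.
rewrite (bigD1 s)//= mulrA gbinom_newton -mulrA mulr_suml mulr_sumr.
have le_mn : (m s <= n)%N by rewrite -mn mdegE (bigD1 s) ?leq_addr.
rewrite [RHS](bigID (fun i : 'I_n => i < m s)%N)/= [X in _ + X]big1 ?addr0; last first.
  by move=> i /negbTE ->; rewrite !mulr0.
rewrite (big_ord_narrow le_mn) /=; apply: eq_bigr => i _ /=.
rewrite ltn_ord mdeg_subXn// mn eqxx -[in LHS]mulrA mulrCA.
congr (_ * (_ * _)); rewrite [RHS](bigD1 s)//=.
rewrite mnmBE mulmnE mnm1E eqxx mul1n; congr (_ * _).
apply: eq_bigr => r /negbTE rs.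
by rewrite mnmBE mulmnE mnm1E eq_sym rs mul0n subn0.
Qed.

End Newton.

(** * Recursions for weighted power sums *)

Section NewtonClosed.
Variables (F : fieldType) (k : nat) (y : {ffun 'I_k -> F}).
Hypothesis char0 : forall n, n.+1%:R != 0 :> F.
Variable S : subringClosed {mpoly F[k]}.
Hypothesis invS : forall n, (n.+1%:R^-1)%:MP \in S.

Lemma e_poly0 : e_poly y 0 = 1.
Proof.
apply/mpolyP => m; rewrite mcoeff_e_poly mcoeff1 mdeg_eq0.
case: eqP => // ->; apply: big1 => s _.
by rewrite /gbinom mnm0E big_ord0 fact0 invr1 mulr1.
Qed.

(** Newton's identity is solved for $e_n$; the division by $n$ stays in [S] by [invS]. *)
Lemma e_poly_psum_closed N : (forall i, (i < N)%N -> psum y i.+1 \in S) ->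
  forall n, (n <= N)%N -> e_poly y n \in S.
Proof.
move=> pS; elim/ltn_ind => -[|n] IHn le_nN; first by rewrite e_poly0 rpred1.
have -> : e_poly y n.+1 = (n.+1%:R^-1)%:MP * (n.+1%:R *: e_poly y n.+1).
  by rewrite mul_mpolyC scalerA mulVf ?scale1r.
rewrite e_poly_newton// rpredM// rpred_sum// => i _.
rewrite rpredM ?rpredX ?rpredN1// rpredM//; first by apply: pS; have := ltn_ord i; lia.
by apply: IHn; lia.
Qed.

(** Newton's identity is solved for its last term, which is $\pm p_n e_0$ with $e_0 = 1$. *)
Lemma psum_e_poly_closed N : (forall i, (i < N)%N -> e_poly y i.+1 \in S) ->
  forall n, (n < N)%N -> psum y n.+1 \in S.
Proof.
move=> eS; elim/ltn_ind => n IHn lt_nN.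
have := e_poly_newton y char0 n.+1; rewrite big_ord_recr /= subnn e_poly0 mulr1.
move/esym/(canRL (addKr _)) => pE.
rewrite -[psum y n.+1](signrMK n) pE rpredM ?rpredX ?rpredN1// rpredD//.
  rewrite rpredN rpred_sum// => i _.
  rewrite rpredM ?rpredX ?rpredN1// rpredM//.
    by apply: IHn => //; apply: ltn_trans lt_nN.
  rewrite subSS; have lt_in := ltn_ord i.
  by rewrite -[(n - i)%N]prednK ?subn_gt0//; apply: eS; lia.
by rewrite scaler_nat rpredMn// eS.
Qed.

End NewtonClosed.

Section PowerSumRecursion.
Variables (A : comNzRingType) (S : subringClosed A) (I : finType) (m : I -> A).
Implicit Types x : I -> A.

Definition wsum x n := \sum_s m s * x s ^+ n.

(** Multiplying the common equation by $m_s x_s^{n-d}$ and summing over $s$ gives a linear recursion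
    of order [d]. Only its coefficients and the initial sums must lie in [S], not the points. *)
Lemma wsum_rec x d (c : nat -> A) :
  (forall i, c i \in S) ->
  (forall s, x s ^+ d = \sum_(i < d) c i * x s ^+ i) ->
  (forall n, (n < d)%N -> wsum x n \in S) -> forall n, wsum x n \in S.
Proof.
move=> cS xE xS; elim/ltn_ind => n IHn.
have [lt_nd|le_dn] := ltnP n d; first exact: xS.
have -> : wsum x n = \sum_(i < d) c i * wsum x (n - d + i).
  rewrite /wsum; under [RHS]eq_bigr => i _ do rewrite mulr_sumr.
  rewrite exchange_big; apply: eq_bigr => s _ /=.
  rewrite -{1}(subnK le_dn) exprD xE mulr_sumr mulr_sumr.
  by apply: eq_bigr => i _; rewrite exprD; ring.
by rewrite rpred_sum// => i _; rewrite rpredM// IHn//; have := ltn_ord i; lia.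
Qed.

Lemma wsum_shift x a N : a \in S ->
  (forall n, (n <= N)%N -> wsum x n \in S) ->
  forall n, (n <= N)%N -> wsum (fun s => x s + a) n \in S.
Proof.
move=> aS xS n le_nN.
have -> : wsum (fun s => x s + a) n =
    \sum_(i < n.+1) (a ^+ i *+ 'C(n, i)) * wsum x (n - i).
  rewrite /wsum; under [RHS]eq_bigr => i _ do rewrite mulr_sumr.
  rewrite exchange_big; apply: eq_bigr => s _ /=.
  rewrite exprDn mulr_sumr; apply: eq_bigr => i _.
  by rewrite -mulrnAr mulrA mulrC.
rewrite rpred_sum// => i _; rewrite rpredM ?rpredMn ?rpredX//.
by apply: xS; apply: leq_trans le_nN; apply: leq_subr.
Qed.

End PowerSumRecursion.

(* All the [x s] are roots of one monic polynomial over [S], so that the power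
   sums obey a linear recursion over [S]. *)
Definition centred_root k (d : nat) :=
  forall (A : comNzRingType) (S : subringClosed A) (m x : 'I_k -> A),
  (forall s, m s \in S) ->
  (forall T : {set 'I_k}, T != finset.set0 ->
     exists2 v, v \in S & v * (\sum_(s in T) m s) = 1) ->
  \sum_s m s * x s = 0 ->
  (forall n, (n <= d)%N -> wsum m x n \in S) ->
  exists2 c : nat -> A, (forall i, c i \in S) &
    forall s, x s ^+ d = \sum_(i < d) c i * x s ^+ i.

Lemma centred_root1 : centred_root 1 1.
Proof.
move=> A S m x mS invS; rewrite big_ord1 => mx0 _.
exists (fun=> 0) => [i|s]; first exact: rpred0.
have [|v _] := invS [set ord0]%SET.
  by apply/set0Pn; exists ord0; rewrite inE.
rewrite big_set1 => vm1; rewrite big_ord1 mul0r expr1 (ord1 s).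
by rewrite -[x _]mul1r -vm1 -mulrA mx0 mulr0.
Qed.

(** The relation $m_0 x_0 + m_1 x_1 = 0$ gives $x_0 = m_1 u$ and $x_1 = -m_0 u$. The cubic used has
    $(m_0 - m_1)u$ as third root, so its roots sum to 0 and it has no square term. Its other
    coefficients involve only $u^2$ and $(m_1 - m_0)u^3$, which are the power sums of degrees 2 and
    3 divided by $m_0 m_1 (m_0 + m_1)$. *)
Lemma centred_root2 : centred_root 2 3.
Proof.
move=> A S m x mS invS; rewrite !big_ord_recl big_ord0 addr0 => mx0 xS.
pose i0 : 'I_2 := ord0; pose i1 : 'I_2 := lift ord0 ord0.
rewrite -/i0 -/i1 in mx0.
have [|v0 v0S v0E] := invS [set i0]%SET; first by apply/set0Pn; exists i0; rewrite inE.
have [|v1 v1S v1E] := invS [set i1]%SET; first by apply/set0Pn; exists i1; rewrite inE.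
have [|v vS vE] := invS [set: 'I_2]%SET; first by apply/set0Pn; exists i0; rewrite inE.
rewrite !big_set1 in v0E v1E.
rewrite big_mkcond !big_ord_recl big_ord0 !inE /= addr0 -/i0 -/i1 in vE.
pose u := x i0 * v1.
have x0E : x i0 = m i1 * u by rewrite /u mulrCA [m _ * _]mulrC v1E mulr1.
have x1E : x i1 = - (m i0 * u).
  rewrite -[LHS]mul1r -v1E -mulrA (_ : m i1 * x i1 = - (m i0 * x i0)) .
    by rewrite /u; ring.
  by apply/eqP; rewrite -addr_eq0 addrC mx0.
pose V := v0 * v1 * v.
have VE : V * (m i0 * m i1 * (m i0 + m i1)) = 1.
  transitivity (v0 * m i0 * (v1 * m i1) * (v * (m i0 + m i1))).
    by rewrite /V; ring.
  by rewrite v0E v1E vE !mulr1.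
have VS : V \in S by rewrite !rpredM.
pose c i := match i with
  | 0 => V * (m i0 * m i1 * wsum m x 3)
  | 1 => V * ((m i0 * m i1 + (m i1 - m i0) ^+ 2) * wsum m x 2)
  | _ => 0 end.
exists c => [[|[|i]]|s]; last first.
- rewrite -[LHS]mul1r -VE -(big_mkord xpredT (fun i => c i * x s ^+ i)).
  rewrite !big_nat_recr//= big_geq// /c /wsum !big_ord_recl !big_ord0 -/i0 -/i1.
  have [->|->] : s = i0 \/ s = i1.
    by case: s => -[|[|//]] lt_s; [left|right]; apply: val_inj.
  + by rewrite x0E x1E; ring.
  + by rewrite x0E x1E; ring.
- exact: rpred0.
- by do ![exact: VS | exact: mS | exact: xS | apply: rpredX | apply: rpredM
         | apply: rpredD | rewrite rpredN].
- by do ![exact: VS | exact: mS | exact: xS | apply: rpredM | apply: rpredD].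
Qed.

(* The coefficients come from solving the linear system expressing that all
   three roots vanish; up to the invertible factor [s1 s3 (s1 s2 - s3)], where
   [s1 s2 - s3] is the product of the three pair sums, they are integral. *)
Lemma centred_root3 : centred_root 3 7.
Proof.
move=> A S m x mS invS; rewrite !big_ord_recl big_ord0 addr0 => mx0 xS.
pose i0 : 'I_3 := ord0; pose i1 : 'I_3 := lift ord0 ord0.
pose i2 : 'I_3 := lift ord0 (lift ord0 ord0).
rewrite -/i0 -/i1 -/i2 in mx0.
have inv (T : {set 'I_3}) i : i \in T ->
    exists2 v, v \in S & v * (\sum_(s in T) m s) = 1.
  by move=> iT; apply: invS; apply/set0Pn; exists i.
have [|v0 v0S v0E] := inv [set i0]%SET i0; first by rewrite !inE.
have [|v1 v1S v1E] := inv [set i1]%SET i1; first by rewrite !inE.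
have [|v2 v2S v2E] := inv [set i2]%SET i2; first by rewrite !inE.
have [|v01 v01S v01E] := inv [set i0; i1]%SET i0; first by rewrite !inE.
have [|v02 v02S v02E] := inv [set i0; i2]%SET i0; first by rewrite !inE.
have [|v12 v12S v12E] := inv [set i1; i2]%SET i1; first by rewrite !inE.
have [|v vS vE] := inv [set: 'I_3]%SET i0; first by rewrite !inE.
have sumE (T : {set 'I_3}) : \sum_(s in T) m s = (if i0 \in T then m i0 else 0) +
    ((if i1 \in T then m i1 else 0) + (if i2 \in T then m i2 else 0)).
  by rewrite big_mkcond !big_ord_recl big_ord0 /= addr0.
rewrite !sumE !inE /= ?addr0 ?add0r in v0E v1E v2E v01E v02E v12E vE.
(* Inverting [m i2] parametrises the solutions of the centring relation polynomially by [u] and [w],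
   so that the root conditions become identities for [ring]. *)
pose u := x i0 * v2; pose w := x i1 * v2.
have x0E : x i0 = m i2 * u by rewrite /u mulrCA [m _ * _]mulrC v2E mulr1.
have x1E : x i1 = m i2 * w by rewrite /w mulrCA [m _ * _]mulrC v2E mulr1.
have x2E : x i2 = - (m i0 * u + m i1 * w).
  rewrite -[LHS]mul1r -v2E -mulrA.
  rewrite (_ : m i2 * x i2 = - (m i0 * x i0 + m i1 * x i1)).
    by rewrite /u /w; ring.
  by apply/eqP; rewrite -addr_eq0 addrC -addrA mx0.
pose s1 := m i0 + m i1 + m i2.
pose s2 := m i0 * m i1 + m i0 * m i2 + m i1 * m i2.
pose s3 := m i0 * m i1 * m i2.
pose V := v0 * v1 * v2 * v01 * v02 * v12 * v.
have VE : V * (s1 * s3 * (s1 * s2 - s3)) = 1.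
  transitivity (v0 * m i0 * (v1 * m i1) * (v2 * m i2) * (v01 * (m i0 + m i1)) *
    (v02 * (m i0 + m i2)) * (v12 * (m i1 + m i2)) * (v * (m i0 + (m i1 + m i2)))).
    by rewrite /V /s1 /s2 /s3; ring.
  by rewrite v0E v1E v2E v01E v02E v12E vE !mulr1.
pose q := wsum m x.
(* Each coefficient [c i] combines products of power sums of total degree $7 - i$. Degree 1 does not
   occur since that sum is 0, whence [c 6 = 0]. *)
pose c i := - (V * match i with
  | 0 => (- s1 ^+ 2 * s2 + 3%:R * s2 ^+ 2 - 2%:R * s1 * s3) * (q 2 ^+ 2 * q 3) +
         (3%:R * s1 ^+ 2 * s3 - 6%:R * s2 * s3) * (q 2 * q 5) +
         (s1 * s2 ^+ 2 - 3%:R * s1 ^+ 2 * s3 + 2%:R * s2 * s3) * (q 3 * q 4) +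
         (- s1 * s2 * s3 + s3 ^+ 2) * q 7
  | 1 => (- s1 ^+ 4 + 6%:R * s1 ^+ 2 * s2 - 9%:R * s2 ^+ 2 - s1 * s3) * q 2 ^+ 3 +
         (s1 ^+ 3 * s2 - 3%:R * s1 * s2 ^+ 2 - 7%:R * s1 ^+ 2 * s3 + 24%:R * s2 * s3) *
           (q 2 * q 4) +
         (3%:R * s1 ^+ 2 * s3 - 8%:R * s2 * s3) * q 3 ^+ 2 +
         (- s1 ^+ 3 * s3 + 3%:R * s1 * s2 * s3 - 7%:R * s3 ^+ 2) * q 6
  | 2 => (9%:R * s1 ^+ 2 * s3 - 24%:R * s2 * s3) * (q 2 * q 3) +
         (- 3%:R * s1 * s2 * s3 + 21%:R * s3 ^+ 2) * q 5
  | 3 => (s1 ^+ 3 * s2 - 3%:R * s1 * s2 ^+ 2 - 7%:R * s1 ^+ 2 * s3 + 24%:R * s2 * s3) *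
           q 2 ^+ 2 +
         (- s1 ^+ 2 * s2 ^+ 2 + 3%:R * s1 ^+ 3 * s3 + 3%:R * s1 * s2 * s3 -
           35%:R * s3 ^+ 2) *
           q 4
  | 4 => (- 5%:R * s1 * s2 * s3 + 35%:R * s3 ^+ 2) * q 3
  | 5 => (- 3%:R * s1 ^+ 3 * s3 + 9%:R * s1 * s2 * s3 - 21%:R * s3 ^+ 2) * q 2
  | _ => 0 end).
have VS : V \in S by rewrite !rpredM.
have s1S : s1 \in S by rewrite !rpredD.
have s2S : s2 \in S by rewrite !(rpredD, rpredM).
have s3S : s3 \in S by rewrite !rpredM.
have qS n : (n <= 7)%N -> q n \in S by apply: xS.
exists c => [i|s].
  rewrite /c rpredN rpredM//; move: i => [|[|[|[|[|[|i]]]]]]; rewrite ?rpred0//;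
  by do ![exact: s1S | exact: s2S | exact: s3S | exact: qS | exact: rpred_nat
         | apply: rpredX | apply: rpredM | apply: rpredD | rewrite rpredN].
rewrite -[LHS]mul1r -VE -(big_mkord xpredT (fun i => c i * x s ^+ i)).
rewrite !big_nat_recr//= big_geq// /c /q /wsum !big_ord_recl !big_ord0 -/i0 -/i1 -/i2.
have [->|[->|->]] : s = i0 \/ s = i1 \/ s = i2.
- by case: s => -[|[|[|//]]] lt_s; [left|right; left|right; right]; apply: val_inj.
- by rewrite x0E x1E x2E /s1 /s2 /s3; ring.
- by rewrite x0E x1E x2E /s1 /s2 /s3; ring.
- by rewrite x0E x1E x2E /s1 /s2 /s3; ring.
Qed.

(** * Separating linear forms *)

(** Translation by the weighted mean [a] reduces to the centred case, and [wsum_shift] carries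
    membership in [S] both ways. The degree bound [d.+1] is positive, so the sum of degree 1 that
    defines [a] is available. *)
Lemma wsum_generated k d (A : comNzRingType) (S : subringClosed A)
    (m x : 'I_k.+1 -> A) :
  centred_root k.+1 d.+1 ->
  (forall s, m s \in S) ->
  (forall T : {set 'I_k.+1}, T != finset.set0 ->
     exists2 v, v \in S & v * (\sum_(s in T) m s) = 1) ->
  (forall n, (n <= d.+1)%N -> wsum m x n \in S) ->
  forall n, wsum m x n \in S.
Proof.
move=> root mS invS xS n.
have [|v vS] := invS [set: 'I_k.+1]%SET; first by apply/set0Pn; exists ord0.
rewrite (eq_bigl xpredT) => [vE|s]; last by rewrite inE.
pose a := v * wsum m x 1.
have aS : a \in S by rewrite rpredM ?xS.
pose y s := x s - a.
have yS : forall i, (i <= d.+1)%N -> wsum m y i \in S.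
  by apply: wsum_shift; rewrite ?rpredN.
have y0 : \sum_s m s * y s = 0.
  rewrite /y; under eq_bigr => s _ do rewrite mulrBr.
  rewrite sumrB -mulr_suml mulrA [_ * v]mulrC vE mul1r.
  apply/eqP; rewrite subr_eq0; apply/eqP/eq_bigr => s _; exact: congr1.
have [c cS yE] := root A S m y mS invS y0 yS.
have ySn i : wsum m y i \in S.
  by apply: (wsum_rec cS yE) => j /ltnW; apply: yS.
have -> : wsum m x n = wsum m (fun s => y s + a) n.
  by apply: eq_bigr => s _; rewrite /y subrK.
by apply: (@wsum_shift _ _ _ m y a n) => // i _.
Qed.

(** * Certificates checked by integer computation *)

Section Certificates.

(** Horner form of $\sum_i 2^i P_i^n$, the power sum with weights $1, 2, 4, \ldots$ *)
Definition dyadic_sum (P : seq Z) (n : nat) : Z :=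
  foldr (fun x acc => x ^+ n + 2%:R * acc) 0 P.

(* A list of pairs (weight, point) stands for the weighted sum of the values of
   a polynomial at the points; [values] replaces each point by the table of its
   power sums of degrees 0, ..., j. *)
Definition values (j : nat) (c : seq (Z * seq Z)) :=
  [seq (u.1, mkseq (dyadic_sum u.2) j.+1) | u <- c].

(** Represents the form $f \mapsto c(p_a f)$. *)
Definition mul_step (a : nat) (c : seq (Z * seq Z)) :=
  [seq (u.1 * nth 0 u.2 a, u.2) | u <- c].

Definition total (c : seq (Z * seq Z)) : Z := foldr (fun u acc => u.1 + acc) 0 c.

(* [vanish n n c] implies that [c] kills all products of power sums of total
   degree [n]; branches on which all the weighted values are already 0, such as
   those using degree 1, are cut. *)
Fixpoint vanish (fuel n : nat) (c : seq (Z * seq Z)) : bool :=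
  all (fun u => u.1 == 0) c ||
  match n, fuel with
  | 0, _ => total c == 0
  | _, 0 => false
  | _, f.+1 => all (fun a => vanish f (n - a) (mul_step a c)) (iota 1 n)
  end.

(** A product of at least two power sums of total degree [j] has a first factor of degree [a < j];
    the first test runs over these [a], the second evaluates the form on $p_j$ itself. *)
Definition separates (j : nat) (c : seq (Z * seq Z)) : bool :=
  let t := values j c in
  all (fun a => vanish j (j - a) (mul_step a t)) (iota 1 j.-1) &&
  (total (mul_step j t) != 0).

Definition word_sum (c : seq (Z * seq Z)) (l : seq nat) : Z :=
  \sum_(u <- c) u.1 * \prod_(a <- l) nth 0 u.2 a.

Lemma word_sum_values j c l : (sumn l <= j)%N ->
  word_sum (values j c) l =
  \sum_(u <- c) u.1 * \prod_(a <- l) dyadic_sum u.2 a.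
Proof.
move=> lj; rewrite /word_sum big_map; apply: eq_bigr => u _; congr (_ * _).
apply: eq_big_seq => a al; rewrite nth_mkseq// ltnS (leq_trans _ lj)//.
by rewrite sumnE (big_rem a)//= leq_addr.
Qed.

Lemma word_sum_cons a l c : word_sum c (a :: l) = word_sum (mul_step a c) l.
Proof.
by rewrite /word_sum big_map; apply: eq_bigr => u _; rewrite big_cons mulrA.
Qed.

Lemma totalE c : total c = word_sum c [::].
Proof.
rewrite /total /word_sum; elim: c => [|u c IHc]; rewrite ?big_nil// big_cons /=.
by rewrite big_nil mulr1 IHc.
Qed.

(** The letters of [l] are consumed one by one along the recursion. Cutting a branch is sound
    because weights that are already 0 annihilate every remaining product. *)
Lemma vanishP fuel n c l : vanish fuel n c ->
  all (leq 1) l -> sumn l = n -> word_sum c l = 0.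
Proof.
have zero c' l' : all (fun u => u.1 == 0) c' -> word_sum c' l' = 0.
  move=> /allP c0; rewrite /word_sum big_seq big1// => u /c0/eqP ->.
  by rewrite mul0r.
elim: fuel n c l => [|fuel IH] [|n] c [|a l] //=.
- by case/orP => [/zero//|/eqP]; rewrite totalE.
- by case: a.
- by rewrite orbF => /zero.
- by case/orP => [/zero//|/eqP]; rewrite totalE.
- by case: a.
case/orP => [/zero//|H] /andP[a0 l0] al; rewrite word_sum_cons.
have {H}/allP H : all (fun a => vanish fuel (n.+1 - a) (mul_step a c)) (iota 1 n.+1).
  exact: H.
by apply: (IH (n.+1 - a)%N) => //; [apply: H; rewrite mem_iota | ]; lia.
Qed.

End Certificates.

(** * Linear forms on polynomials attached to certificates *)

Section Separation.
Variables (K : numFieldType) (k : nat).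

Definition dyadic : {ffun 'I_k -> K} := [ffun s : 'I_k => (2 ^ s)%:R].

Local Notation dpsum := (psum dyadic).
Local Notation zr z := ((int_of_Z z)%:~R : K).

Local Notation ray P :=
  (mmap (@polyC K) (fun s : 'I_k => (zr (nth 0 P s))%:P * 'X)).

Lemma ray_psum P n : (size P <= k)%N -> (0 < n)%N ->
  ray P (dpsum n) = (zr (dyadic_sum P n))%:P * 'X^n.
Proof.
move=> le_Pk n0; rewrite /psum rmorph_sum /=.
under eq_bigr => s _.
  rewrite -mul_mpolyC rmorphM rmorphXn /= mmapC mmapX mmap1U.
  rewrite exprMn mulrA -rmorphXn -rmorphM /=.
over.
rewrite -mulr_suml -rmorph_sum; congr (_%:P * _).

rewrite (eq_bigr (fun s : 'I_k => (2 ^ s)%:R * zr (nth 0 P s) ^+ n)); last first.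
  by move=> s _; rewrite ffunE.
(* Coordinates past the end of [P] default to 0 and contribute nothing because [n] is positive. *)
have zero i : zr (nth 0 (@nil Z) i) ^+ n = 0.
  by rewrite nth_nil mulr0z expr0n gtn_eqF.
elim: P k le_Pk => [|x P IH] [|k'] //= le_Pk.
- by rewrite big_ord0.
- by rewrite big1 ?mulr0z// => s _; rewrite zero mulr0.
rewrite big_ord_recl mul1r !rmorphD !rmorphM !rmorphXn /=; congr (_ + _).
rewrite -(IH k')// mulr_sumr; apply: eq_bigr => s _.
by rewrite /= /bump add1n expnS natrM -mulrA.
Qed.

Definition word (l : seq nat) : {mpoly K[k]} := \prod_(a <- l) dpsum a.

(* the weighted sum of the t^j-coefficients of [f (t P)] over the points P *)
Definition cert_form (c : seq (Z * seq Z)) (j : nat) (f : {mpoly K[k]}) : K :=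
  \sum_(u <- c) zr u.1 * (ray u.2 f)`_j.

Lemma cert_form_is_linear c j : scalar (cert_form c j).
Proof.
move=> a f g; rewrite /cert_form mulr_sumr -big_split /=.
apply: eq_bigr => u _; rewrite rmorphD /= mmapZ coefD coefCM; ring.
Qed.

HB.instance Definition _ c j :=
  GRing.isLinear.Build K {mpoly K[k]} K _ (cert_form c j) (cert_form_is_linear c j).

(** A word is homogeneous of degree [sumn l], hence a monomial in $t$ along each line $tP$. *)
Lemma cert_form_word c j l :
  all (fun u => size u.2 <= k)%N c -> all (leq 1) l ->
  cert_form c j (word l) =
    if sumn l == j then zr (word_sum (values j c) l) else 0.
Proof.
move=> /allP ck l0.
have rayE u : u \in c ->
    ray u.2 (word l) = (zr (\prod_(a <- l) dyadic_sum u.2 a))%:P * 'X^(sumn l).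
  move=> /ck uk; rewrite /word; elim: l l0 => [|a l IH] /= => [_|/andP[a0 l0]].
    by rewrite !big_nil !rmorph1 mul1r.
  rewrite !big_cons rmorphM /= ray_psum// IH// !rmorphM exprD /=; ring.
rewrite /cert_form; case: eqP => [lj|nlj].
  rewrite word_sum_values ?lj// rmorph_sum rmorph_sum /= big_seq [RHS]big_seq.
  apply: eq_bigr => u uc; rewrite rayE// coefCM coefXn lj eqxx mulr1 !rmorphM //.
rewrite big_seq big1// => u uc; rewrite rayE// coefCM coefXn.
by case: eqP => [/esym|_]; rewrite ?mulr0.
Qed.

(** The words killed include the empty one and the single letters other than [j], so [L] also kills
    constants and the other power sums. *)
Definition separating (j : nat) (L : {mpoly K[k]} -> K) :=
  (forall l, all (leq 1) l -> l <> [:: j] -> L (word l) = 0) /\ L (dpsum j) != 0.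

(** Words of degree other than [j] die by homogeneity. A word of degree [j] other than [[:: j]] has
    at least two letters, so its first letter is below [j] and the certificate applies. *)
Lemma cert_form_separating c j : (0 < j)%N ->
  all (fun u => size u.2 <= k)%N c -> separates j c ->
  separating j (cert_form c j).
Proof.
move=> j0 ck /andP[/allP cj cj0]; split=> [l l0 nlj|].
  rewrite cert_form_word//; case: eqP => // lj.
  case: l l0 nlj lj => [|a l] /= => [_ _ /esym j00|/andP[a0 l0] nlj lj].
    by rewrite j00 in j0.
  rewrite word_sum_cons (@vanishP j (j - a) (mul_step a (values j c)) l) ?mulr0z//; last lia.
  apply: cj; rewrite mem_iota; suff: (0 < sumn l)%N by lia.
  by case: l l0 nlj lj => [|b l] /=; [rewrite addn0 => _ + aj; rewrite aj|lia].
have := @cert_form_word c j [:: j] ck; rewrite /= addn0 eqxx j0 /word big_seq1 => -> //.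
rewrite word_sum_cons -totalE intr_eq0; apply: contra cj0 => /eqP.
by move=> /(congr1 Z_of_int); rewrite int_of_ZK => ->.
Qed.

End Separation.

(** * Embedding dimension at the origin *)

Section EmbeddingDimension.
Variables (K : numFieldType) (k : nat).
Local Notation dpsum := (psum (dyadic K k)).
Local Notation word := (word K k).

(** This is the subalgebra generated by the power sums of positive degree, presented by explicit
    linear combinations on which linear forms can be evaluated. *)
Definition word_span : set {mpoly K[k]} :=
  [set f | exists2 s : seq (K * seq nat), all (fun u => all (leq 1) u.2) s &
     f = \sum_(u <- s) u.1 *: word u.2].

Lemma word_cat l l' : word (l ++ l') = word l * word l'.
Proof. exact: big_cat. Qed.

Lemma word_span_subalg : GRing.subalg_closed (mem word_span).
Proof.
split=> [|a f g|f g].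
- by apply/mem_set; exists [:: (1, [::])]; rewrite // big_seq1 scale1r /= /word big_nil.
- move=> /set_mem[s s0 ->] /set_mem[t t0 ->]; apply/mem_set.
  exists ([seq (a * u.1, u.2) | u <- s] ++ t); first by rewrite all_cat all_map s0 t0.
  rewrite big_cat big_map scaler_sumr; congr (_ + _).
  by apply: eq_bigr => u _; rewrite scalerA.
- move=> /set_mem[s /allP s0 ->] /set_mem[t /allP t0 ->]; apply/mem_set.
  exists [seq (u.1 * v.1, u.2 ++ v.2) | u <- s, v <- t].
    apply/allP => _ /allpairsP[[u v] /= [us vt ->]] /=.
    by rewrite all_cat s0 ?t0.
  rewrite big_allpairs_dep mulr_suml; apply: eq_bigr => u _.
  rewrite mulr_sumr; apply: eq_bigr => v _ /=.
  by rewrite -scalerAl -scalerAr scalerA word_cat.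
Qed.

Definition in_word_span : {pred {mpoly K[k]}} := mem word_span.

HB.instance Definition _ :=
  GRing.isSubalgClosed.Build K {mpoly K[k]} in_word_span word_span_subalg.

Lemma psum_word_span n : (0 < n)%N -> word_span (dpsum n).
Proof.
move=> n0; exists [:: (1, [:: n])]; first by rewrite /= n0.
by rewrite big_seq1 scale1r /word big_seq1.
Qed.

Lemma word_at0 l : all (leq 1) l -> (word l).@[fun=> 0] = (l == [::])%:R.
Proof.
case: l => [|[//|n] l] _; first by rewrite /word big_nil meval1.
rewrite /word big_cons mevalM [X in X * _](_ : _ = 0) ?mul0r//.
rewrite /psum raddf_sum /= big1// => s _.
by rewrite mevalZ rmorphXn /= mevalXU expr0n mulr0.
Qed.

(* A separating functional is a derivation at the origin. *)
Lemma separating_mul j (L : {scalar {mpoly K[k]}}) f g :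
  separating j L -> word_span f -> word_span g ->
  L (f * g) = f.@[fun=> 0] * L g + g.@[fun=> 0] * L f.
Proof.
move=> [Lw _] [s /allP s0 ->] [t /allP t0 ->].
(* If one word is empty, it has value 1 at the origin and [L] kills it. Otherwise the concatenation
   has at least two letters and is killed, while both words vanish at the origin. *)
have Lword l l' : all (leq 1) l -> all (leq 1) l' ->
    L (word l * word l') =
    (word l).@[fun=> 0] * L (word l') + (word l').@[fun=> 0] * L (word l).
  move=> l0 l'0; rewrite -word_cat !word_at0//.
  have L1 : L (word [::]) = 0 by apply: Lw.
  case: l l0 => [|a [|b l]] l0; case: l' l'0 => [|a' l'] l'0;
    rewrite ?cats0 ?L1 ?mul1r ?mul0r ?addr0 ?add0r//; apply: Lw => //;
    by rewrite all_cat l0.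
have Lwordl l : all (leq 1) l -> L (word l * \sum_(u <- t) u.1 *: word u.2) =
    (word l).@[fun=> 0] * L (\sum_(u <- t) u.1 *: word u.2) +
    (\sum_(u <- t) u.1 *: word u.2).@[fun=> 0] * L (word l).
  move=> l0; rewrite mulr_sumr !linear_sum /= ?raddf_sum mulr_sumr mulr_suml.
  rewrite -big_split /=.
  rewrite big_seq [RHS]big_seq; apply: eq_bigr => u ut.
  by rewrite -scalerAr !linearZ /= Lword ?t0// ?mevalZ; ring.
move: (\sum_(u <- t) _) Lwordl => h Lwordl.
rewrite mulr_suml !linear_sum /= ?raddf_sum.
rewrite mulr_suml mulr_sumr -big_split /=.
rewrite big_seq [RHS]big_seq; apply: eq_bigr => u us.
by rewrite -scalerAl !linearZ /= Lwordl ?s0// ?mevalZ; ring.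
Qed.

(* The linear parts of the elements of [word_span] make up an N-dimensional
   space, whereas those of polynomials in the [b i] are spanned by n vectors. *)
Lemma separating_generators N n (L : 'I_N -> {scalar {mpoly K[k]}})
    (b : 'I_n -> {mpoly K[k]}) :
  (forall j : 'I_N, separating j.+1 (L j)) ->
  (forall i, word_span (b i)) ->
  (forall j : 'I_N, exists p : {mpoly K[n]},
     forall i, L i (dpsum j.+1) = L i (mmap (@mpolyC k K) b p)) ->
  (N <= n)%N.
Proof.
move=> Lsep bW bgen.
pose D f : 'rV[K]_N := \row_j L j f.
have D_lin a f g : D (a *: f + g) = a *: D f + D g.
  by apply/rowP => j; rewrite !mxE linearP.
(* By the product rule, the elements whose [D] lies in the row space of [M] form a subalgebra; it
   contains the [b i], hence all polynomials in them. *)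
pose M := \matrix_(i < n) D (b i).
pose V : set {mpoly K[k]} := [set f | word_span f /\ (D f <= M)%MS].
have [W1 Wlin Wmul] := word_span_subalg.
have W0 : word_span 0 by exists [::]; rewrite ?big_nil.
have D0 : D 0 = 0 by apply/rowP => j; rewrite !mxE linear0.
have V0 : V 0 by split; rewrite ?D0 ?sub0mx.
have V1 : V 1.
  split; first exact: set_mem W1.
  rewrite (_ : D 1 = 0) ?sub0mx//; apply/rowP => j; rewrite !mxE.
  by have := (Lsep j).1 [::]; rewrite /word big_nil => ->.
have Vlin a f g : V f -> V g -> V (a *: f + g).
  move=> [Wf Df] [Wg Dg]; split; first exact/set_mem/Wlin/mem_set/Wg/mem_set/Wf.
  by rewrite D_lin addmx_sub// scalemx_sub.
have Vmul f g : V f -> V g -> V (f * g).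
  move=> [Wf Df] [Wg Dg]; split; first exact/set_mem/Wmul/mem_set/Wg/mem_set/Wf.
  rewrite (_ : D (f * g) = f.@[fun=> 0] *: D g + g.@[fun=> 0] *: D f).
    by rewrite addmx_sub// scalemx_sub.
  by apply/rowP => j; rewrite !mxE (separating_mul (Lsep j)).
have Vb i : V (b i) by split=> //; rewrite -(rowK (fun i => D (b i)) i) row_sub.
have Vgen p : V (mmap (@mpolyC k K) b p).
  rewrite /mmap; elim: (msupp p : seq _) => [|m s IH]; first by rewrite big_nil.
  rewrite big_cons mul_mpolyC; apply: Vlin => //; rewrite /mmap1.
  elim/big_ind: _ => // i _; elim: (m i) => [|e IHe]; first by rewrite expr0.
  by rewrite exprS; apply: Vmul.
(* [D] sends the power sums to nonzero multiples of the unit rows, so [M] has rank [N], but it has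
   only [n] rows. *)
suff /mxrankS : (1%:M <= M)%MS.
  by rewrite mxrank1 => /leq_trans -> //; apply: rank_leq_row.
apply/row_subP => j; rewrite row1.
have [p pE] := bgen j; have [_] := Vgen p.
rewrite (_ : D (mmap _ _ _) = D (dpsum j.+1)) => [DM|]; last first.
  by apply/rowP => i; rewrite !mxE pE.
have [_ Lj0] := Lsep j.
rewrite (_ : delta_mx 0 j = (L j (dpsum j.+1))^-1 *: D (dpsum j.+1)) ?scalemx_sub//.
apply/rowP => i; rewrite !mxE eqxx /=; case: eqP => [->|ne_ij].
  by rewrite mulVf.
rewrite (_ : dpsum j.+1 = word [:: j.+1]) ?(Lsep i).1 ?mulr0//; last first.
  by rewrite /word big_seq1.
by move=> [] /val_inj/esym.
Qed.

End EmbeddingDimension.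

(** * Closed embeddings and generators *)

Section Embeddings.
Variables (K : fieldType) (B : comAlgType K) (n : nat).

Local Notation ev b := (mmap (GRing.in_alg B) b).

Lemma spec_mmap (x : spec B) (b : 'I_n -> B) (p : {mpoly K[n]}) :
  x (ev b p) = p.@[fun i => x (b i)].
Proof.
rewrite /mmap rmorph_sum mevalE; apply: eq_bigr => m _.
rewrite /mmap1 rmorphM rmorph_prod /= linearZ /= rmorph1.
congr (_ * _); first exact: mulr1.
by apply: eq_bigr => i _; rewrite rmorphXn.
Qed.

Lemma spec_ext (x y : spec B) : x =1 y -> x = y.
Proof.
case: x y => [f [[f1] [f2] [f3]]] [g [[g1] [g2] [g3]]] /= /funext fg.
subst g; congr (GRing.LRMorphism.Pack (GRing.LRMorphism.Class _ _ _));
  [congr Algebra.isNmodMorphism.Axioms_ | congr GRing.isMonoidMorphism.Axioms_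
  | congr GRing.isScalable.Axioms_]; exact: Prop_irrelevance.
Qed.

(** The [b i] are the pullbacks of the coordinates. Any [f] descends along the injective [phi] to a
    function on the image, which is regular and therefore polynomial. Equality is obtained at the
    points of the spectrum only. *)
Lemma embeds_closed_coordinates : embeds_closed B n ->
  exists b : 'I_n -> B, forall f, exists p : {mpoly K[n]},
    forall x : spec B, x f = x (ev b p).
Proof.
case=> phi [phi_inj _ phi_reg].
have /choice[b bE] i : exists b : B, forall x : spec B, phi x i = x b.
  apply/(phi_reg (fun z => z i)); exists 'X_i => z _.
  by rewrite mevalXU.
exists b => f.
(* On the image, injectivity makes the value independent of the chosen preimage; the value 0
   elsewhere is arbitrary. *)
pose g z := if pselect (exists x, phi x = z) is left ex then projT1 (cid ex) f else 0.
have gE x : g (phi x) = x f.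
  rewrite /g; case: pselect => [ex|[]]; last by exists x.
  by case: cid => y /= /phi_inj ->.
have [p pE] : regular_on (range phi) g by apply/phi_reg; exists f.
exists p => x; rewrite spec_mmap -gE pE; last by exists x.
by apply: meval_eq => i; rewrite bE.
Qed.

(** The image is the zero set of the kernel of $K[X_1, \ldots, X_n] \to B$. A point [z] of that set
    comes from the character sending [f] to the value at [z] of any polynomial representing [f]; two
    representatives differ by an element of the kernel, which vanishes at [z]. *)
Lemma generated_embeds_closed (b : 'I_n -> B) :
  (forall f, exists p : {mpoly K[n]}, f = ev b p) -> embeds_closed B n.
Proof.
move=> /choice[p pE].
exists (fun x : spec B => [ffun i => x (b i)]).
have coordE (x : spec B) q : q.@[[ffun i => x (b i)]] = x (ev b q).
  by rewrite spec_mmap; apply: meval_eq => i; rewrite ffunE.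
split.
- move=> x y /ffunP xy; apply: spec_ext => f; rewrite (pE f) !spec_mmap.
  by apply: meval_eq => i; have := xy i; rewrite !ffunE.
- exists [set q | ev b q = 0]; rewrite predeqE => z; split=> [[x _ <-] q /= q0|z0].
    by rewrite coordE q0 rmorph0.
  have indep q r : ev b q = ev b r -> q.@[z] = r.@[z].
    move=> qr; apply/eqP; rewrite -subr_eq0 -rmorphB; apply/eqP/z0.
    by rewrite /= rmorphB /= qr subrr.
  pose x f : K^o := (p f).@[z].
  have xlin : linear x.
    move=> a f g; rewrite /x (indep _ (a *: p f + p g)).
      by rewrite rmorphD /= mevalZ.
    by rewrite -pE rmorphD /= mmapZ -!pE /= -scalerAl mul1r.
  have xmul : multiplicative x.
    split=> [f g|]; rewrite /x.
      rewrite (indep _ (p f * p g)); first by rewrite rmorphM.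
      by rewrite rmorphM /= -!pE.
    rewrite (indep _ 1); first by rewrite rmorph1.
    by rewrite -pE rmorph1.
  pose xadd := GRing.isLinear.Build K B K^o _ x xlin.
  pose xmul' := GRing.isMultiplicative.Build B K^o x xmul.
  pose xx : spec B := HB.pack x xadd xmul'.
  exists xx => //; apply/ffunP => i; rewrite ffunE /= /x.
  by rewrite (indep _ 'X_i) ?mevalXU // -pE mmapX mmap1U.
- move=> g; split=> [[q qE]|[f fE]].
    by exists (ev b q) => x; rewrite qE ?coordE//; exists x.
  by exists (p f) => z [x _ <-]; rewrite fE coordE -pE.
Qed.

End Embeddings.

(** * Upper bounds at a point *)

Section Generation.
Variables (K : fieldType) (A : comAlgType K) (n : nat) (b : 'I_n -> A).

Definition polys_in : set A :=
  [set f | exists p : {mpoly K[n]}, f = mmap (GRing.in_alg A) b p].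

Lemma polys_in_subalg : GRing.subalg_closed (mem polys_in).
Proof.
split=> [|a f g|f g].
- by apply/mem_set; exists 1; rewrite rmorph1.
- move=> /set_mem[p ->] /set_mem[q ->]; apply/mem_set; exists (a *: p + q).
  by rewrite rmorphD /= mmapZ mulr_algl.
- move=> /set_mem[p ->] /set_mem[q ->]; apply/mem_set; exists (p * q).
  by rewrite rmorphM.
Qed.

Definition in_polys_in : {pred A} := mem polys_in.

HB.instance Definition _ :=
  GRing.isSubalgClosed.Build K A in_polys_in polys_in_subalg.

Lemma gen_in_polys_in i : b i \in in_polys_in.
Proof. by apply/mem_set; exists 'X_i; rewrite mmapX mmap1U. Qed.

Lemma genAlg_embeds_closed (G : set A) :
  (forall i, b i \in in_subalg_gen G) -> (forall f, G f -> f \in in_polys_in) ->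
  embeds_closed (genAlg G) n.
Proof.
move=> bG Gb; pose b' i : genAlg G := GenAlg (bG i).
apply: (@generated_embeds_closed _ _ _ b') => f.
have /set_mem[p pE] : val f \in in_polys_in.
  have /set_mem fG := genAlg_valP f.
  apply: (mem_set (fG _ _)); split; first exact: polys_in_subalg.
  by move=> g /Gb/set_mem.
pose v : {rmorphism genAlg G -> A} := val.
exists p; apply: val_inj; rewrite pE -[RHS]/(v _) /mmap (rmorph_sum v).
apply: eq_bigr => m _; rewrite (rmorphM v) (rmorph_prod v); congr (_ * _).
by apply: eq_bigr => i _; rewrite (rmorphXn v).
Qed.

End Generation.

Section PointwiseUpper.
Variables (K : fieldType) (k : nat) (P : {ffun 'I_k -> K}).
Hypothesis char0 : forall n, n.+1%:R != 0 :> K.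

Definition in_Delta : {pred {mpoly K[k]}} :=
  in_subalg_gen (e_poly P @` [set j | (1 <= j)%N]).

HB.instance Definition _ := GRing.SubalgClosed.copy in_Delta
  (in_subalg_gen (e_poly P @` [set j | (1 <= j)%N])).

Lemma mem_subalg_const (S : subalgClosed {mpoly K[k]}) c : c%:MP \in S.
Proof. by rewrite -alg_mpolyC rpredZ ?rpred1. Qed.

Lemma e_poly_in_Delta n : e_poly P n.+1 \in in_Delta.
Proof. by apply/mem_set => S [_]; apply; exists n.+1. Qed.

Lemma psum_in_Delta n : psum P n.+1 \in in_Delta.
Proof.
by apply: (psum_e_poly_closed char0 (N := n.+1)) => // i _; apply: e_poly_in_Delta.
Qed.

Lemma psum_wsum n : psum P n = wsum (fun s => (P s)%:MP) (fun s => 'X_s) n.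
Proof. by apply: eq_bigr => s _; rewrite mul_mpolyC. Qed.

End PointwiseUpper.

(** The generators are the first [d.+1] power sums. Weights and inverses of subset sums are
    constants, so [wsum_generated] applies to the subalgebra of polynomials in these generators, and
    Newton's identities then reach every [e_poly]. *)
Lemma Delta_embeds (K : fieldType) k d (P : {ffun 'I_k.+1 -> K}) :
  (forall n, n.+1%:R != 0 :> K) -> centred_root k.+1 d.+1 ->
  generic_points P -> embeds_closed (Delta_alg P) d.+1.
Proof.
move=> char0 root gP; pose b (i : 'I_d.+1) := psum P i.+1.
apply: (@genAlg_embeds_closed _ _ _ b) => [i|_ [n n0 <-]].
  exact: psum_in_Delta.
apply: (e_poly_psum_closed char0 _ _ (leqnn n)) => [i|i _].
  exact: (@mem_subalg_const _ _ (in_polys_in b)).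
rewrite psum_wsum; apply: (wsum_generated root) => [s|T /gP T0|j].
- exact: (@mem_subalg_const _ _ (in_polys_in b)).
- exists ((\sum_(s in T) P s)^-1)%:MP.
    exact: (@mem_subalg_const _ _ (in_polys_in b)).
  by rewrite -rmorph_sum -rmorphM /= mulVf.
- rewrite -psum_wsum; case: j => [|j] lt_jd.
    rewrite /psum rpred_sum// => s _; rewrite expr0 alg_mpolyC.
    exact: (@mem_subalg_const _ _ (in_polys_in b)).
  by have := gen_in_polys_in b (Ordinal lt_jd).
Qed.

Lemma gbinom_nat (K : fieldType) (m i : nat) :
  (m < i)%N -> gbinom (m%:R : K) i = 0.
Proof.
move=> lt_mi; rewrite /gbinom (bigD1 (Ordinal lt_mi))//= subrr mul0r.
by rewrite mul0r.
Qed.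

(** A monomial of such a degree has some exponent exceeding [m s], where the binomial coefficient is
    0. *)
Lemma e_poly_nat0 (K : fieldType) k (m : 'I_k -> nat) n :
  (\sum_s m s < n)%N -> e_poly [ffun s => (m s)%:R : K] n = 0.
Proof.
move=> lt_mn; apply/mpolyP => e; rewrite mcoeff_e_poly mcoeff0; case: eqP => // eE.
have [s lt_me] : exists s, (m s < e s)%N.
  apply/existsP; apply: contraLR lt_mn; rewrite negb_exists -leqNgt -eE mdegE.
  by move=> /forallP me; apply: leq_sum => s _; rewrite leqNgt me.
by rewrite (bigD1 s)//= ffunE gbinom_nat ?mul0r.
Qed.

Lemma Delta_nat_embeds (K : fieldType) k (m : 'I_k -> nat) :
  embeds_closed (Delta_alg [ffun s => (m s)%:R : K]) (\sum_s m s).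
Proof.
set P := [ffun s => _]; pose b (i : 'I_(\sum_s m s)) := e_poly P i.+1.
apply: (@genAlg_embeds_closed _ _ _ b) => [i|_ [n n0 <-]].
  exact: e_poly_in_Delta.
have [lt_mn|le_nm] := ltnP (\sum_s m s)%N n; first by rewrite e_poly_nat0 ?rpred0.
case: n n0 le_nm => // n _ lt_nm.
exact: (gen_in_polys_in b (Ordinal lt_nm)).
Qed.

(** * Lower bounds at the dyadic point *)

Section PointwiseLower.
Variables (K : numFieldType) (k : nat).
Local Notation dpsum := (psum (dyadic K k)).
Local Notation zr z := ((int_of_Z z)%:~R : K).

Lemma poly_eq_values (p q : {poly K}) : (forall t, p.[t] = q.[t]) -> p = q.
Proof.
move=> pq; apply/eqP; rewrite -subr_eq0; apply/negPn/negP => pq0.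
have := @max_poly_roots _ _ [seq i%:R | i <- iota 0 (size (p - q)%R)] pq0.
rewrite size_map size_iota ltnn => abs; apply: notF; apply: abs.
  by apply/allP => t _; rewrite /root hornerD hornerN pq subrr.
by rewrite map_inj_uniq ?iota_uniq// => i j /eqP; rewrite eqr_nat => /eqP.
Qed.

(** An embedding yields equalities only at points, so the form has to depend on values alone; on
    each line $tP$ this holds because [K] is infinite. *)
Lemma cert_form_ext c j (f g : {mpoly K[k]}) :
  (forall v : 'I_k -> K, f.@[v] = g.@[v]) -> cert_form c j f = cert_form c j g.
Proof.
move=> fg; apply: eq_bigr => u _.
pose ray := mmap (@polyC K) (fun s : 'I_k => (zr (nth 0 u.2 s))%:P * 'X).
have rayE (h : {mpoly K[k]}) t : (ray h).[t] = h.@[fun s => zr (nth 0 u.2 s) * t].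
  rewrite /ray /mmap horner_sum mevalE; apply: eq_bigr => m _.
  rewrite hornerM hornerC /mmap1 horner_prod; congr (_ * _).
  by apply: eq_bigr => s _; rewrite horner_exp hornerM hornerC hornerX.
suff E : ray f = ray g by rewrite -/(ray f) -/(ray g) E.
by apply: poly_eq_values => t; rewrite !rayE fg.
Qed.

Lemma Delta_dyadic_word_span f :
  f \in in_subalg_gen (e_poly (dyadic K k) @` [set j | (1 <= j)%N]) ->
  @word_span K k f.
Proof.
have char0 n : n.+1%:R != 0 :> K by rewrite pnatr_eq0.
move/set_mem => fG; apply: (fG (@word_span K k)); split; first exact: word_span_subalg.
move=> _ [n n0 <-]; apply: set_mem.
apply: (@e_poly_psum_closed _ _ _ char0 (@in_word_span K k) _ n) => // [i|i _].
  exact: mem_subalg_const.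
by apply/mem_set/psum_word_span.
Qed.

Lemma Delta_dyadic_lower N n (c : 'I_N -> seq (Z * seq Z)) :
  (forall j : 'I_N, separating j.+1 (@cert_form K k (c j) j.+1)) ->
  embeds_closed (Delta_alg (dyadic K k)) n -> (N <= n)%N.
Proof.
have char0 m : m.+1%:R != 0 :> K by rewrite pnatr_eq0.
move=> csep /embeds_closed_coordinates[b bE].
pose L j : {scalar {mpoly K[k]}} := @cert_form K k (c j) j.+1.
apply: (@separating_generators K k N n L (fun i => val (b i))) => // [i|j].
  exact: Delta_dyadic_word_span (genAlg_valP (b i)).
pose f : Delta_alg (dyadic K k) := GenAlg (psum_in_Delta (dyadic K k) char0 j).
have [p pE] := bE f; exists p => i; apply: cert_form_ext => v.
pose V : {rmorphism Delta_alg (dyadic K k) -> {mpoly K[k]}} := val.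
(* Evaluation at any [v] is a point of the spectrum, so equality at the points gives equal values of
   the polynomials on all of $K^k$. *)
pose x (g : Delta_alg (dyadic K k)) : K^o := (val g).@[v].
have xlin : linear x by move=> a g h; rewrite /x [val _]linearP mevalD mevalZ.
have xmul : multiplicative x.
  split=> [g h|]; rewrite /x; first by rewrite [val _](rmorphM V) mevalM.
  by rewrite [val _](rmorph1 V) meval1.
pose xadd := GRing.isLinear.Build K (Delta_alg (dyadic K k)) K^o _ x xlin.
pose xmul' := GRing.isMultiplicative.Build (Delta_alg (dyadic K k)) K^o x xmul.
pose xx : spec (Delta_alg (dyadic K k)) := HB.pack x xadd xmul'.
have := pE xx; rewrite spec_mmap => E.
transitivity (xx f) => //; rewrite E mevalE /mmap raddf_sum.
apply: eq_bigr => m _; rewrite [RHS]mevalM mevalC /mmap1 rmorph_prod; congr (_ * _).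
by apply: eq_bigr => s _; rewrite rmorphXn.
Qed.

End PointwiseLower.

(** * The universal ring *)

Section SubringGen.
Variables (A : nzRingType) (G : set A).

Definition in_subring_gen : {pred A} := mem (subring_gen G).

Lemma in_subring_gen_closed : GRing.subring_closed in_subring_gen.
Proof.
split=> [|u v|u v].
- by apply/mem_set => S [[S1 _ _] _]; apply/set_mem.
- move=> /set_mem Su /set_mem Sv; apply/mem_set => S HS.
  case: (HS) => -[_ SB _] _; apply/set_mem/SB; apply/mem_set.
    exact: (Su S HS).
  exact: (Sv S HS).
- move=> /set_mem Su /set_mem Sv; apply/mem_set => S HS.
  case: (HS) => -[_ _ SM] _; apply/set_mem/SM; apply/mem_set.
    exact: (Su S HS).
  exact: (Sv S HS).
Qed.

HB.instance Definition _ :=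
  GRing.isSubringClosed.Build A in_subring_gen in_subring_gen_closed.

Lemma subring_gen_min (S : subringClosed A) x :
  (forall y, G y -> y \in S) -> x \in in_subring_gen -> x \in S.
Proof.
move=> GS /set_mem xG; apply: (xG [set y | y \in S]); split=> //.
have memS y : (y \in mem [set z | z \in S]) = (y \in S).
  by apply/idP/idP => [/set_mem|yS]; last apply/mem_set.
split=> [|u v|u v]; rewrite !memS; [exact: rpred1|exact: rpredB|exact: rpredM].
Qed.

End SubringGen.

Section UniversalRing.
Variables (K : fieldType) (k : nat).
Hypothesis char0 : forall n, n.+1%:R != 0 :> K.

Local Notation F := (ratfun K k).
Local Notation tof := (@tofrac {mpoly K[k]}).

Lemma char0_ratfun n : n.+1%:R != 0 :> F.
Proof.
by rewrite -(rmorph_nat tof) tofrac_eq0 -(rmorph_nat (@mpolyC k K)) mpolyC_eq0.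
Qed.

Definition in_Rring i : {pred {mpoly F[k]}} := mem (@Rring K k i).

Lemma in_Rring_closed i : GRing.subring_closed (in_Rring i).
Proof. exact: in_subring_gen_closed. Qed.

HB.instance Definition _ i :=
  GRing.isSubringClosed.Build {mpoly F[k]} (in_Rring i) (in_Rring_closed i).

Lemma coef_ring_tofrac p : @coef_ring K k (tof p).
Proof. by move=> S [_]; apply; left; exists p. Qed.

Lemma Rring_const i c : @coef_ring K k c -> c%:MP \in in_Rring i.
Proof. by move=> cR; apply/mem_set => S [_]; apply; left; exists c. Qed.

Lemma Rring_e_poly i j : (j < i)%N -> e_poly (mvars K k) j.+1 \in in_Rring i.
Proof. by move=> ji; apply/mem_set => S [_]; apply; right; exists j.+1. Qed.

Lemma Rring_psum i j : (j < i)%N -> psum (mvars K k) j.+1 \in in_Rring i.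
Proof.
apply: (psum_e_poly_closed char0_ratfun) => n; exact: Rring_e_poly.
Qed.

Lemma coef_ring_inv_nat n : @coef_ring K k n.+1%:R^-1.
Proof.
rewrite (_ : _^-1 = tof (n.+1%:R^-1)%:MP); first exact: coef_ring_tofrac.
apply: (mulfI (char0_ratfun n)); rewrite divff ?char0_ratfun//.
rewrite -(rmorph_nat tof) -rmorphM -(rmorph_nat (@mpolyC k K)) -rmorphM.
by rewrite divff ?rmorph1.
Qed.

Lemma sum_mvars (T : {set 'I_k}) : \sum_(s in T) mvars K k s = tof (\sum_(s in T) 'X_s).
Proof. by rewrite rmorph_sum; apply: eq_bigr => s _; rewrite ffunE. Qed.

Lemma sum_mvars_neq0 (T : {set 'I_k}) : T != finset.set0 ->
  \sum_(s in T) mvars K k s != 0.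
Proof.
rewrite -card_gt0 => T0; rewrite sum_mvars tofrac_eq0.
apply/eqP => /(congr1 (meval (fun=> 1))); rewrite meval0 raddf_sum /=.
under eq_bigr => s _ do rewrite mevalXU.
by rewrite sumr_const; apply/eqP; case: #|T| T0.
Qed.

End UniversalRing.

(** The argument at a point is repeated over the field of rational functions, with [Rring] as the
    subring: the coefficient ring contains the weights and the inverses of their subset sums. *)
Lemma Rring_stable (K : fieldType) k d :
  (forall n, n.+1%:R != 0 :> K) -> centred_root k.+1 d.+1 ->
  forall j, (d.+1 <= j)%N -> @Rring K k.+1 d.+1 = @Rring K k.+1 j.
Proof.
move=> char0 root j le_dj; rewrite predeqE => g; split => [gR|/mem_set gR].
  apply: set_mem.
  apply: (subring_gen_min (S := @in_Rring K k.+1 j) _ (mem_set gR)).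
  move=> _ [[c cR <-]|[n /andP[n0 nd] <-]].
    exact: Rring_const.
  by case: n n0 nd => // n _ nd; apply: Rring_e_poly; apply: leq_trans le_dj.
apply: set_mem; apply: (subring_gen_min (S := @in_Rring K k.+1 d.+1) _ gR).
move=> _ [[c cR <-]|[n _ <-]].
  exact: Rring_const.
apply: (e_poly_psum_closed (char0_ratfun _ char0) _ _ (leqnn n)) => [i|i _].
  by apply: Rring_const; apply: coef_ring_inv_nat.
have mS s : (mvars K k.+1 s)%:MP \in @in_Rring K k.+1 d.+1.
  by apply: Rring_const; rewrite ffunE; apply: coef_ring_tofrac.
rewrite psum_wsum; apply: (wsum_generated root) => [//|T T0|l].
- exists ((\sum_(s in T) mvars K k.+1 s)^-1)%:MP.
    by apply: Rring_const => U [_]; apply; right; exists T.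
  by rewrite -rmorph_sum -rmorphM /= mulVf// sum_mvars_neq0.
- rewrite -psum_wsum; case: l => [|l] lt_ld; last exact: Rring_psum.
  by rewrite /psum rpred_sum// => s _; rewrite expr0 alg_mpolyC.
Qed.

(** * Specialising the universal weights to a point *)

Section Specialization.
Variables (K : fieldType) (k : nat) (P : {ffun 'I_k -> K}).
Hypothesis char0 : forall n, n.+1%:R != 0 :> K.
Hypothesis genP : generic_points P.

Local Notation F := (ratfun K k).
Local Notation tof := (@tofrac {mpoly K[k]}).

(** The local ring at [P], with denominators cleared so that no value of a fraction has to be
    defined. *)
Definition regular_at : set F :=
  [set c | exists b h : {mpoly K[k]}, b.@[P] != 0 /\ tof b * c = tof h].

Lemma regular_at_subring : GRing.subring_closed (mem regular_at).
Proof.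
split=> [|c d|c d].
- by apply/mem_set; exists 1, 1; rewrite meval1 oner_neq0 mulr1.
- move=> /set_mem[b [h [b0 bE]]] /set_mem[b' [h' [b'0 b'E]]]; apply/mem_set.
  exists (b * b'), (b' * h - b * h'); rewrite mevalM mulf_neq0//; split=> //.
  by rewrite rmorphB !rmorphM /= -bE -b'E; ring.
- move=> /set_mem[b [h [b0 bE]]] /set_mem[b' [h' [b'0 b'E]]]; apply/mem_set.
  exists (b * b'), (h * h'); rewrite mevalM mulf_neq0//; split=> //.
  by rewrite !rmorphM /= -bE -b'E; ring.
Qed.

Definition in_regular_at : {pred F} := mem regular_at.

HB.instance Definition _ :=
  GRing.isSubringClosed.Build F in_regular_at regular_at_subring.

Lemma coef_ring_regular_at c : coef_ring c -> regular_at c.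
Proof.
move=> /mem_set cR; apply/set_mem.
apply: (subring_gen_min (S := in_regular_at) _ cR) => _ [[p _ <-]|[T T0 ->]].
  by apply/mem_set; exists 1, p; rewrite meval1 oner_neq0 rmorph1 mul1r.
apply/mem_set; exists (\sum_(s in T) 'X_s), 1; split; last first.
  by rewrite -sum_mvars mulfV ?rmorph1// sum_mvars_neq0.
rewrite raddf_sum /=; under eq_bigr => s _ do rewrite mevalXU.
exact: genP.
Qed.

Variable V : subalgClosed {mpoly K[k]}.

Local Notation up h := (map_mpoly tof h).
Local Notation at_P h := (map_mpoly (meval P) h).

(** Expresses that [g] can be specialised at [P] with result in [V]: [g] is $h/b$ with $b(P) \neq
    0$, and dividing by the scalar $b(P)$ does not leave [V]. *)
Definition specializes : set {mpoly F[k]} :=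
  [set g | exists b (h : {mpoly {mpoly K[k]}[k]}),
     [/\ b.@[P] != 0, tof b *: g = up h & at_P h \in V]].

Lemma specializes_subring : GRing.subring_closed (mem specializes).
Proof.
split=> [|c d|c d].
- apply/mem_set; exists 1, 1; rewrite meval1 oner_neq0 !rmorph1 scale1r.
  by rewrite rpred1.
- move=> /set_mem[b [h [b0 bE hV]]] /set_mem[b' [h' [b'0 b'E h'V]]]; apply/mem_set.
  exists (b * b'), (b'%:MP * h - b%:MP * h'); split.
  + by rewrite mevalM mulf_neq0.
  + rewrite rmorphB !rmorphM /= !map_mpolyC -bE -b'E scalerBr -!mul_mpolyC rmorphM /=.
    by ring.
  + rewrite rmorphB !rmorphM /= !map_mpolyC !mul_mpolyC -scaleNr.
    by rewrite rpredD// rpredZ.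
- move=> /set_mem[b [h [b0 bE hV]]] /set_mem[b' [h' [b'0 b'E h'V]]]; apply/mem_set.
  exists (b * b'), (h * h'); split.
  + by rewrite mevalM mulf_neq0.
  + by rewrite !rmorphM /= -bE -b'E -scalerAl -scalerAr scalerA.
  + by rewrite rmorphM rpredM.
Qed.

Definition in_specializes : {pred {mpoly F[k]}} := mem specializes.

HB.instance Definition _ :=
  GRing.isSubringClosed.Build {mpoly F[k]} in_specializes specializes_subring.

Lemma specializes_const c : coef_ring c -> c%:MP \in in_specializes.
Proof.
move=> /coef_ring_regular_at[b [h [b0 bE]]]; apply/mem_set.
exists b, h%:MP; split=> //; rewrite map_mpolyC; last exact: mem_subalg_const.
by rewrite /= -bE mpolyCM mul_mpolyC.
Qed.

(** The first ['X_s] is the weight $m_s$, the second the variable $x_s$. *)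
Definition psum_univ n : {mpoly {mpoly K[k]}[k]} := \sum_s 'X_s *: 'X_s ^+ n.

Lemma psum_univ_up n : up (psum_univ n) = psum (mvars K k) n.
Proof.
rewrite /psum_univ rmorph_sum; apply: eq_bigr => s _ /=.
by rewrite map_mpolyZ rmorphXn /= map_mpolyX ffunE.
Qed.

Lemma psum_univ_at n : at_P (psum_univ n) = psum P n.
Proof.
rewrite /psum_univ rmorph_sum; apply: eq_bigr => s _ /=.
by rewrite map_mpolyZ rmorphXn /= map_mpolyX mevalXU.
Qed.

Lemma Rring_specializes i :
  (forall n, (n < i)%N -> psum P n.+1 \in V) ->
  forall g, Rring i g -> specializes g.
Proof.
move=> psV g /mem_set gR; apply/set_mem.
apply: (subring_gen_min (S := in_specializes) _ gR).
move=> _ [[c cR <-]|[n /andP[n0 ni] <-]].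
  exact: specializes_const.
have charF := char0_ratfun k char0.
apply: (@e_poly_psum_closed _ _ _ charF in_specializes _ i) => // [j|j ji].
  by apply: specializes_const; apply: coef_ring_inv_nat.
apply/mem_set; exists 1, (psum_univ j.+1).
by rewrite meval1 oner_neq0 rmorph1 scale1r psum_univ_up psum_univ_at psV.
Qed.

(** The relation $b\,p_n = h$ descends from rational functions to polynomials in the weights; it is
    evaluated at [P] and divided by $b(P)$. *)
Lemma psum_Rring_specializes n i :
  (forall n, (n < i)%N -> psum P n.+1 \in V) ->
  Rring i (psum (mvars K k) n) -> psum P n \in V.
Proof.
move=> psV /(Rring_specializes psV)[b [h [b0 bE hV]]].
have hE : h = b *: psum_univ n.
  apply/mpolyP => m; apply/eqP; rewrite -tofrac_eq; apply/eqP.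
  have := congr1 (mcoeff m) bE; rewrite mcoeff_map_mpoly /= => <-.
  by rewrite -psum_univ_up !mcoeffZ mcoeff_map_mpoly rmorphM.
rewrite -psum_univ_at -[at_P _]scale1r -(mulVf b0) -scalerA rpredZ//.
by rewrite -map_mpolyZ -hE.
Qed.

End Specialization.

(** * The certificates and the theorem *)

Section CertificateData.
Local Open Scope Z_scope.

(* Integer points at which the power sum of degree 1 vanishes (except in the
   case j = 1).  Those for j < 2 ^ i involve only the first i coordinates. *)
Definition cert_points (j : nat) : seq (seq Z) :=
  if (j < 2)%N then [:: [:: 1]]
  else if (j < 4)%N then [:: [:: 2; -1]]
  else if (j < 8)%N then
    [:: [:: 0; 2; -1]; [:: 2; -1; 0]; [:: 2; 1; -1]; [:: 2; -3; 1]; [:: 2; 3;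
    -2]]
  else
    [:: [:: 0; 0; 2; -1]; [:: 0; 2; -1; 0]; [:: 0; 2; 1; -1]; [:: 2; -1; -2;
    1]; [:: 2; -1; 0; 0]; [:: 2; -1; 2; -1]; [:: 2; 1; -1; 0]; [:: 2; 1; 1;
    -1]; [:: 0; 2; -3; 1]; [:: 0; 2; 3; -2]; [:: 2; -3; -3; 2]; [:: 2; -3; -1;
    1]; [:: 2; -3; 1; 0]; [:: 2; -3; 3; -1]; [:: 2; 1; -3; 1]; [:: 2; 1; 3;
    -2]; [:: 2; 3; -2; 0]; [:: 2; 3; 0; -1]; [:: 2; 3; 2; -2]; [:: 0; 4; -4;
    1]; [:: 0; 4; 0; -1]; [:: 0; 4; 4; -3]; [:: 2; -1; -4; 2]; [:: 2; -1; 4;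
    -2]; [:: 2; 3; -4; 1]; [:: 2; 3; 4; -3]; [:: 4; -4; -3; 2]; [:: 4; -4; -1;
    1]; [:: 4; -4; 1; 0]; [:: 4; -4; 3; -1]; [:: 4; -2; -2; 1]; [:: 4; -2; 2;
    -1]; [:: 4; 0; -3; 1]; [:: 4; 0; -1; 0]; [:: 4; 0; 1; -1]; [:: 4; 0; 3;
    -2]; [:: 4; 2; -4; 1]; [:: 4; 2; 0; -1]; [:: 4; 2; 4; -3]; [:: 4; 4; -3;
    0]; [:: 4; 4; -1; -1]; [:: 4; 4; 1; -2]; [:: 4; 4; 3; -3]; [:: 0; 2; -5;
    2]; [:: 0; 2; 5; -3]; [:: 2; -5; -4; 3]; [:: 2; -5; -2; 2]; [:: 2; -5; 0;
    1]; [:: 2; -5; 2; 0]; [:: 2; -5; 4; -1]; [:: 2; -3; -5; 3]; [:: 2; -3; 5;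
    -2]; [:: 2; 1; -5; 2]; [:: 2; 1; 5; -3]].

(* Short vectors of the lattice of integer relations between the values of the
   decomposable monomials of degree j in the power sums. *)
Definition cert_weights : nat -> seq Z := nth [::] [::
    [::]; [:: 1]; [:: 1]; [:: 1];
    [:: -1; 4];
    [:: -1; 4];
    [:: 8; 55; -63; -1; 1];
    [:: 182; 52; -117; 9];
    [:: -25; 100; 0; 0; -200; 8];
    [:: -25; 100; 0; 0; -200; 8];
    [:: 10440; -9302; 12094; -1142; -354; -1569; -1830; -3285; -276; 48; 7;
    -228; 250; 30; 126; -78; -23];
    [:: 4583; 15286; -43152; 600; 23255; 1225; 24115; -32308; -364; -70; 2;
    -737; 712; -9; 324; -59; -100; 101; 319];
    [:: -21451; 48558; -589144; 96561; 55783; 55673; -194588; -95422; 31866;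
    -214764; 4657; 337293; -302487; -24860; -92282; 193853; 106257; -546337;
    -5421; -733; 16167; 481; -8231; 7739; 3471; -171; 240; -1530; 740; 387;
    -12576; 8392; 6928; -6985];
    [:: -589111; 87348; 6100; 629599; 1366033; 317701; 104577; -544803; -4494;
    -181110; -34049; -78147; 87381; 20065; 241167; 143393; -441009; 723367;
    72657; 4645; -9033; -405; -1193; -4998; -7929; -516; -268; 604; -4161;
    4077; -6523; -43420; 12129; -23121; 52992; 17132; -3379];
    [:: -4739737110; 870176615; -1223635530; 458640665; 1190997080; 4367626369;
    -2699954245; -1360241705; -622466278; 350099452; 82895005; -1564865847;
    1751114835; 80474647; -69151371; -2206001175; -764563218; 4335344660;
    1710747135; 341787; -31929984; 13062; -16740470; 3220620; 58073; 3679326;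
    -7218877; 2239748; -2904453; 4781776; 774820; 110465270; -7462049;
    54098319; 4125184; -29466260; 1505165; -150613860; 5681427; -5075125;
    -8484065; 4004372; -10036782; 399963; 1891538; -641489; -1170351];
    [:: 81826889919; -213683863481; 176045987804; 311797364434; 73649322318;
    -68086704520; 6524999878; 22781884078; -54860040507; 161082464334;
    -5547985814; -40441334114; -45087570648; 1773211352; 145610866191;
    72269358470; -25787742495; 16794027902; -26484735381; 47702570;
    17529694473; -240250770; -8956153577; 2376696653; -229936960; -2373211264;
    -111339870; -203947911; 134311211; -102819926; 392442912; 2809339951;
    58447831; 2245626444; -3317784080; -1282723959; -53540520; -444283996;
    942000357; -53049178; 69427475; 1225571664; 1485891739; 1074385389;
    -155381035; -10674952; 66674835; 597321322; 44096895; -3451066; 72720838;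
    -73560254; -931634904; -30103825]
  ].

End CertificateData.

(** Several [j] share one list of points; [zip] keeps only as many of them as there are weights. *)
Definition cert (j : nat) := zip (cert_weights j) (cert_points j).

Lemma cert_separates : all (fun j => separates j (cert j)) (iota 1 15).
Proof. by vm_compute. Qed.

Lemma cert_size : all (fun k => all (fun j => all (fun u => size u.2 <= k)%N (cert j))
  (iota 1 (2 ^ k).-1)) (iota 1 4).
Proof. by vm_compute. Qed.

Lemma dyadic_separating (K : numFieldType) k j : (0 < k <= 4)%N -> (0 < j < 2 ^ k)%N ->
  separating j (@cert_form K k (cert j) j).
Proof.
move=> k4 jk; apply: cert_form_separating; first by case/andP: jk.
  have /allP/(_ k) := cert_size; rewrite mem_iota => /(_ k4)/allP; apply.
  by rewrite mem_iota; lia.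
have /allP := cert_separates; apply; rewrite mem_iota.
have : (2 ^ k <= 2 ^ 4)%N by rewrite leq_exp2l//; case/andP: k4.
have -> : (2 ^ 4 = 16)%N by []; lia.
Qed.

Lemma dyadic_lower (K : numFieldType) k n : (0 < k <= 4)%N ->
  embeds_closed (Delta_alg (dyadic K k)) n -> (2 ^ k - 1 <= n)%N.
Proof.
move=> k4; pose c (j : 'I_(2 ^ k - 1)) := cert j.+1.
apply: (@Delta_dyadic_lower K k _ _ c) => j.
by apply: dyadic_separating => //; have := ltn_ord j; lia.
Qed.

Lemma centred_root_small k : (k < 3)%N -> centred_root k.+1 (2 ^ k.+1 - 1).
Proof.
case: k => [|[|[|//]]] _.
- exact: centred_root1.
- exact: centred_root2.
- exact: centred_root3.
Qed.

Lemma dyadic_generic (K : numFieldType) k : generic_points (dyadic K k).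
Proof.
move=> T /set0Pn[s sT]; rewrite gt_eqF// (bigD1 s)//= ltr_pwDl//.
  by rewrite ffunE ltr0n expn_gt0.
by apply: sumr_ge0 => i _; rewrite ffunE ler0n.
Qed.

Lemma posnat_generic (K : numFieldType) k (P : {ffun 'I_k -> K}) :
  posnat_points P -> generic_points P.
Proof.
move=> posP T /set0Pn[s sT].
have P0 i : 0 < P i by have [m m0 ->] := posP i; rewrite ltr0n.
by rewrite gt_eqF// (bigD1 s)//= ltr_pwDl// sumr_ge0// => i _; apply: ltW.
Qed.

Lemma pow2_pred k : (2 ^ k.+1 - 1 = (2 ^ k.+1 - 2).+1)%N.
Proof. by rewrite expnS; have := expn_gt0 2 k; lia. Qed.

Lemma dyadic_is_N (K : numFieldType) k : (k < 3)%N ->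
  is_N K k.+1 (2 ^ k.+1 - 1).
Proof.
have char0 n : n.+1%:R != 0 :> K by rewrite pnatr_eq0.
move=> k3; have root := centred_root_small k3.
have d0 := pow2_pred k.
split=> [j|i istable]; first by move: root; rewrite d0 => root; apply: Rring_stable.
rewrite leqNgt; apply/negP => lt_i.
have k4 : (0 < k.+1 <= 4)%N by lia.
have jI : (0 < 2 ^ k.+1 - 1 < 2 ^ k.+1)%N by rewrite d0; lia.
have Lsep := @dyadic_separating K k.+1 _ k4 jI.
pose L : {scalar {mpoly K[k.+1]}} :=
  @cert_form K k.+1 (cert (2 ^ k.+1 - 1)) (2 ^ k.+1 - 1).
(* The kernel of a derivation at the origin is a subalgebra. It contains the power sums of degrees 1
   to [i] but not that of degree [2 ^ k.+1 - 1], which would specialise into it if the chain were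
   stable from [i] on. *)
pose V := [set f | @word_span K k.+1 f /\ L f = 0].
have Vsub : GRing.subalg_closed (mem V).
  have [W1 Wlin Wmul] := @word_span_subalg K k.+1; split=> [|a f g|f g].
  - apply/mem_set; split; first exact: set_mem W1.
    by have := Lsep.1 [::]; rewrite /word big_nil; apply.
  - move=> /set_mem[Wf Lf] /set_mem[Wg Lg]; apply/mem_set; split.
      exact/set_mem/Wlin/mem_set/Wg/mem_set/Wf.
    by rewrite linearP Lf Lg mulr0 addr0.
  - move=> /set_mem[Wf Lf] /set_mem[Wg Lg]; apply/mem_set; split.
      exact/set_mem/Wmul/mem_set/Wg/mem_set/Wf.
    by rewrite (separating_mul (L := L) Lsep)// Lf Lg !mulr0 addr0.
pose VS : subalgClosed {mpoly K[k.+1]} :=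
  HB.pack (mem V : {pred {mpoly K[k.+1]}})
    (GRing.isSubalgClosed.Build _ _ (mem V) Vsub).
have : psum (dyadic K k.+1) (2 ^ k.+1 - 1) \in VS.
  apply: (@psum_Rring_specializes K k.+1 _ char0 (@dyadic_generic K k.+1) VS _ i).
    move=> n lt_ni; apply/mem_set; split; first exact: psum_word_span.
    have := Lsep.1 [:: n.+1]; rewrite /word big_seq1; apply=> // -[nE].
    by move: lt_i; rewrite -nE ltnNge lt_ni.
  rewrite (istable _ (ltnW lt_i)) d0; apply: set_mem.
  by apply: Rring_psum.
by move=> /set_mem[_ L0]; case: Lsep => _ /eqP[].
Qed.

Lemma is_N_at_le (K : fieldType) k (P : {ffun 'I_k -> K}) d :
  embeds_closed (Delta_alg P) d -> exists2 n, is_N_at P n & (n <= d)%N.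
Proof.
move=> Pd; have ex : exists n, `[< embeds_closed (Delta_alg P) n >].
  by exists d; apply/asboolP.
case: (ex_minnP ex) => n /asboolP Pn min; exists n.
  by split=> // m /asboolP; apply: min.
by apply/min/asboolP.
Qed.

Lemma dyadic_is_N_at (K : numFieldType) k : (0 < k <= 4)%N ->
  embeds_closed (Delta_alg (dyadic K k)) (2 ^ k - 1) ->
  is_N_at (dyadic K k) (2 ^ k - 1)%N.
Proof. by move=> k4 emb; split=> // n; apply: dyadic_lower. Qed.

(** Covers both maxima at once: the upper bound holds at all generic points and is attained at the
    dyadic point. *)
Lemma is_max_on_dyadic (K : numFieldType) k (D : set {ffun 'I_k.+1 -> K}) :
  (k < 3)%N -> D (dyadic K k.+1) -> (forall P, D P -> generic_points P) ->
  is_max_on D (@is_N_at K k.+1) (2 ^ k.+1 - 1)%N.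
Proof.
move=> k3 DP Dgen.
have char0 n : n.+1%:R != 0 :> K by rewrite pnatr_eq0.
have emb P : D P -> embeds_closed (Delta_alg P) (2 ^ k.+1 - 1).
  have := centred_root_small k3.
  rewrite pow2_pred.
  by move=> root /Dgen; apply: Delta_embeds.
split=> [P /emb|]; first exact: is_N_at_le.
by exists (dyadic K k.+1) => //; apply: dyadic_is_N_at; [lia | exact: emb].
Qed.

Theorem theorem1p12 (R : realType) :
  (forall k : nat, k \in [:: 1; 2; 3]%N ->
    [/\ is_max_on (@posnat_points R[i] k) (@is_N_at R[i] k) (2 ^ k - 1)%N,
        is_max_on (@generic_points R[i] k) (@is_N_at R[i] k) (2 ^ k - 1)%N
      & is_N R[i] k (2 ^ k - 1)%N]) /\
  is_N_at ([ffun s : 'I_4 => (nth 0%N [:: 1; 2; 4; 8]%N s)%:R]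
             : {ffun 'I_4 -> R[i]}) 15%N.
Proof.
split=> [[|k] // kI|].
  have k3 : (k < 3)%N by move: kI; rewrite !inE; lia.
  split; last exact: dyadic_is_N.
    apply: is_max_on_dyadic => // [s|P]; last exact: posnat_generic.
    by exists (2 ^ s)%N; rewrite ?expn_gt0 ?ffunE.
  by apply: is_max_on_dyadic => //; apply: dyadic_generic.
have -> : [ffun s : 'I_4 => (nth 0%N [:: 1; 2; 4; 8]%N s)%:R] = dyadic R[i] 4.
  by apply/ffunP => -[[|[|[|[|//]]]] s4]; rewrite !ffunE.
apply: (@dyadic_is_N_at _ 4) => //.
(* The weights sum to $1 + 2 + 4 + 8 = 15$, which meets the lower bound $2^4 - 1$. *)
have := @Delta_nat_embeds R[i] 4 (fun s => (2 ^ s)%N).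
by rewrite !big_ord_recl big_ord0.
Qed.
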